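(* Suppose that there exists an absolute constant $c>0$ such that for every $n\geq 5$, every $G\in\{A_n,S_n\}$ and every vertex $x^G$ of $\Xi(G)$, the vertex $x^G$ is adjacent in $\Xi(G)$ to a conjugacy class whose elements have at most $c$ cycles. Then there exists $n_0$ such that for every $n\geq n_0$ and every $G\in\{A_n,S_n\}$ one has $d(\Xi(G))\leq 4$.
   Context: A subset $\{x_1,\ldots,x_t\}$ of a finite group $G$ invariably generates $G$ if $\langle x_1^{g_1},\ldots,x_t^{g_t}\rangle=G$ for all $g_1,\ldots,g_t\in G$ (where $x^g$ denotes a conjugate of $x$). The invariably generating graph $\Lambda(G)$ is the undirected graph whose vertices are the conjugacy classes of $G$ different from $\{1\}$, two vertices $x^G$ and $y^G$ being adjacent if and only if $\{x,y\}$ invariably generates $G$. The graph $\Xi(G)$ is obtained from $\Lambda(G)$ by removing the isolated vertices (those adjacent to no vertex), and $d(\Xi(G))$ denotes its diameter (which is infinite if the graph is disconnected). The number of cycles of a permutation of $n$ points is the number of parts of its cycle type, fixed points being counted as cycles of length $1$. *)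

(* Defs.v *)
From HB Require Import structures.
From mathcomp Require Import all_boot all_order all_algebra.
From mathcomp Require Import all_fingroup all_solvable.
From mathcomp Require Import constructive_ereal.

Set Implicit Arguments.
Unset Strict Implicit.
Unset Printing Implicit Defensive.

Import Order.TTheory GRing.Theory Num.Theory.

Local Open Scope group_scope.

Section Graphs.
Variables (T : finType) (V : {set T}) (e : rel T).

Definition has_walk (k : nat) (u v : T) : bool :=
  [exists p : k.-tuple T, path e u p && (last u p == v)].

(* If v is reachable from u, a shortest walk has fewer than #|T| edges, so the
   bound on k loses nothing; otherwise the minimum is empty, hence +oo. *)
Definition dist (u v : T) : \bar int :=
  \big[Order.min/+oo%E]_(k < #|T| | has_walk k u v) (Posz k)%:E.

Definition diameter : \bar int :=
  \big[Order.max/0%E]_(u in V) \big[Order.max/0%E]_(v in V) dist u v.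

Lemma dist_leP (u v : T) (m : nat) :
  reflect (exists p, [/\ path e u p, last u p = v & (size p <= m)%N])
          (dist u v <= (Posz m)%:E)%E.
Proof.
apply: (iffP idP) => [le_m|[p [ep lp sp]]].
  have [/existsP[k /andP[/existsP[p /andP[ep /eqP lp]] km]]|no] := boolP
    [exists k : 'I_#|T|, has_walk k u v && (k <= m)%N].
    by exists p; rewrite size_tuple.
  suff: ((Posz m)%:E < dist u v)%E by rewrite ltNge le_m.
  rewrite /dist; elim/big_ind: _ => [|a b ha hb|k wk]; first exact: ltry.
    by rewrite lt_min ha hb.
  rewrite lte_fin ltz_nat ltnNge; apply/negP => km.
  by case/negP: no; apply/existsP; exists k; rewrite wk km.
case/shortenP: ep lp => q eq uq sub_q lq.
have sq : (size q < #|T|)%N.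
  by rewrite -[(size q).+1]/(size (u :: q)) -(card_uniqP uq) max_card.
have wq : has_walk (Ordinal sq) u v.
  by apply/existsP; exists (in_tuple q); rewrite eq lq eqxx.
have /le_trans := @bigmin_le_cond _ _ _ (+oo%E : \bar int) (Ordinal sq)
  (fun k => has_walk k u v) (fun k => (Posz k)%:E) wq.
apply; rewrite lee_fin lez_nat /=; apply: leq_trans sp.
by apply: uniq_leq_size sub_q; case/andP: uq.
Qed.

Lemma diameter_leP (m : nat) :
  reflect {in V &, forall u v,
             exists p, [/\ path e u p, last u p = v & (size p <= m)%N]}
          (diameter <= (Posz m)%:E)%E.
Proof.
have m0 : (0 <= (Posz m)%:E :> \bar int)%E by rewrite lee_fin.
apply: (iffP idP) => [/bigmax_leP[_ H] u v uV vV|H].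
  by have /bigmax_leP[_ H'] := H u uV; apply/dist_leP/H'.
apply/bigmax_leP; split=> // u uV; apply/bigmax_leP; split=> // v vV.
exact/dist_leP/H.
Qed.

End Graphs.

Section InvariableGeneration.
Variables (gT : finGroupType) (G : {group gT}).

Definition invariably_generates (X : {set gT}) : bool :=
  (X \subset G) &&
  [forall g : {ffun gT -> gT}, (g \in ffun_on (mem G)) ==>
     (<<[set x ^ g x | x in X]>> == G)].

Definition Lambda_vertices : {set {set gT}} := classes G :\ [set 1].

(* The choice of representatives is immaterial, see Lambda_adjE below. The
   condition C != D makes the graph simple. *)
Definition Lambda_adj : rel {set gT} := [rel C D |
  [&& C \in Lambda_vertices, D \in Lambda_vertices, C != D &
      invariably_generates [set repr C; repr D]]].

Definition Xi_vertices : {set {set gT}} :=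
  [set C in Lambda_vertices | [exists D, Lambda_adj C D]].

Definition Xi_adj : rel {set gT} := [rel C D |
  [&& C \in Xi_vertices, D \in Xi_vertices & Lambda_adj C D]].

Lemma invariably_generates_pairP (x y : gT) :
    x \in G -> y \in G -> x != y ->
  reflect {in G &, forall a b, <<[set x ^ a; y ^ b]>> = G}
          (invariably_generates [set x; y]).
Proof.
move=> xG yG xy; apply: (iffP andP) => [[_ /forallP H] a b aG bG|H].
  pose g := [ffun z => if z == x then a else b].
  have /implyP/(_ _)/eqP <- := H g.
    by rewrite imsetU !imset_set1 !ffunE eqxx eq_sym (negPf xy).
  by apply/ffun_onP => z; rewrite ffunE; case: ifP.
split; first by apply/subsetP => z; rewrite !inE => /orP[]/eqP->.
apply/forallP => g; apply/implyP => /ffun_onP gG.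
by rewrite imsetU !imset_set1 H.
Qed.

Lemma Lambda_adjE (x y : gT) : x \in G -> y \in G ->
  Lambda_adj (x ^: G) (y ^: G) =
  [&& x != 1, y != 1, x ^: G != y ^: G & invariably_generates [set x; y]].
Proof.
move=> xG yG; rewrite /Lambda_adj /Lambda_vertices /= !inE !mem_classes // !andbT.
have c1 z : (z ^: G == [set 1]) = (z == 1).
  by rewrite -(classG_eq1 G).
rewrite !c1; do 2!congr (_ && _).
have [//|neC /=] := eqVneq (x ^: G) (y ^: G).
have [a aG ra] := repr_class G x; have [b bG rb] := repr_class G y.
have ne u v : u \in G -> v \in G -> x ^ u != y ^ v.
  move=> uG vG; apply: contraNneq neC => E.
  by rewrite -(classGidl x uG) -(classGidl y vG) E.
have nxy : x != y by rewrite -(conjg1 x) -(conjg1 y) ne.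
rewrite ra rb; apply/invariably_generates_pairP/invariably_generates_pairP;
  rewrite ?groupJ ?ne // => H u v uG vG.
  by have := H (a^-1 * u) (b^-1 * v); rewrite -!conjgM !mulKVg; apply;
     rewrite groupM ?groupV.
by rewrite -!conjgM H ?groupM.
Qed.

End InvariableGeneration.

(* Main.v *)
Require Import Defs.
From mathcomp Require Import all_boot all_order all_algebra.
From mathcomp Require Import all_fingroup all_solvable.
From mathcomp Require Import constructive_ereal.
From mathcomp Require Import zify.

(* Two vertices have neighbours D_1 and D_2 with at most c cycles, so the sizes of
   the invariant subsets of elements of D_1 and D_2 form a set S of bounded
   cardinality.  It suffices to find z such that <x^a, z^b> contains Alt for every
   x with invariant sizes in S and all a, b, and whose parity puts z in G but, when
   G = Sym, not in Alt: then z^G is a common neighbour of D_1 and D_2.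

   Take z with three or four cycles (the choice is dictated by parity): one of
   length a = 3^j, bounded in terms of c, and the others prime to 3, distinct,
   almost equal, and such that no union of cycles has its size in S.  Then
   <x^a, z^b> is transitive; comparing blocks with the cycles of z shows that it
   is primitive.  A power of z is a cycle of length a, so Jordan's theorem makes
   the group 2-transitive; since a^2 < n - 1, counting gives two conjugates of
   this cycle whose supports meet in a single point, their commutator is a
   3-cycle, and 2-transitivity yields all 3-cycles. *)

Set Implicit Arguments.
Unset Strict Implicit.
Unset Printing Implicit Defensive.

(** * Jordan sets and 3-cycles *)

Section PermutationGroups.
Local Open Scope group_scope.
Variable T : finType.
Implicit Types (A B C : {set T}) (G : {group {perm T}}).

(** Equivalently, the pointwise stabiliser of the complement of [A] is transitive on [A]. For
    transitive [G] and [A] the complement of a point, this is 2-transitivity. *)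
Definition jordan_set G A :=
  [forall u in A, forall v in A, exists h in G, perm_on A h && (h u == v)].

(** Singletons and the empty set qualify, so primitivity is expressed below through blocks with
    [1 < #|B|]. *)
Definition is_block G B :=
  [forall g in G, (g @: B == B) || [disjoint g @: B & B]].

Lemma jordan_setP G A :
  reflect {in A &, forall u v, exists h, [/\ h \in G, perm_on A h & h u = v]}
          (jordan_set G A).
Proof.
apply: (iffP forall_inP) => [H u v uA vA|H u uA].
  have /forall_inP/(_ v vA)/exists_inP[h hG /andP[hA /eqP huv]] := H u uA.
  by exists h.
apply/forall_inP => v vA; have [h [hG hA huv]] := H u v uA vA.
by apply/exists_inP; exists h; rewrite // hA huv eqxx.
Qed.

Lemma is_blockP G B :
  reflect (forall g x, g \in G -> x \in B -> g x \in B -> g @: B = B)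
          (is_block G B).
Proof.
apply: (iffP forall_inP) => [H g x gG xB gxB|H g gG].
  have /orP[/eqP//|/pred0P/(_ (g x))/=] := H g gG.
  by rewrite gxB imset_f.
have [//|ngB] := eqVneq; apply/pred0P => y /=; apply/negP => /andP[].
case/imsetP => x xB -> gxB; case/eqP: ngB; exact: H gxB.
Qed.

Lemma perm_onW A B (s : {perm T}) : A \subset B -> perm_on A s -> perm_on B s.
Proof. by move=> sAB sA; apply: subset_trans sA sAB. Qed.

Lemma perm_onJ A (s g : {perm T}) : perm_on A s -> perm_on (g @: A) (s ^ g).
Proof.
move=> /subsetP sA; apply/subsetP => x; rewrite inE => sx.
rewrite -(permKV g x) mem_imset; last exact: perm_inj.
by apply: sA; rewrite inE; apply: contraNneq sx => E;
  rewrite -{1}(permKV g x) permJ E permKV.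
Qed.

(** Every point of the union is carried to [w] inside [A] or inside [B]; one such move followed by
    the inverse of another joins any two points. *)
Lemma jordan_setU G A B w :
  w \in A -> w \in B -> jordan_set G A -> jordan_set G B ->
  jordan_set G (A :|: B).
Proof.
move=> wA wB /jordan_setP JA /jordan_setP JB.
have to_w u : u \in A :|: B -> exists h, [/\ h \in G, perm_on (A :|: B) h & h u = w].
  rewrite inE => /orP[uA|uB].
    by have [h [? ? ?]] := JA u w uA wA; exists h; split=> //;
       apply: perm_onW (subsetUl _ _) _.
  by have [h [? ? ?]] := JB u w uB wB; exists h; split=> //;
     apply: perm_onW (subsetUr _ _) _.
apply/jordan_setP => u v /to_w[h [hG hAB hu]] /to_w[k [kG kAB kv]].
exists (h * k^-1); split; first by rewrite groupM ?groupV.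
  by rewrite perm_onM ?perm_onV.
by rewrite permM hu -kv permK.
Qed.

Lemma jordan_setJ G A g : g \in G -> jordan_set G A -> jordan_set G (g @: A).
Proof.
move=> gG /jordan_setP JA; apply/jordan_setP => _ _ /imsetP[u uA ->] /imsetP[v vA ->].
have [h [hG hA hu]] := JA u v uA vA; exists (h ^ g); split.
- by rewrite groupJ.
- exact: perm_onJ.
- by rewrite permJ hu.
Qed.

Lemma card_imset_perm (g : {perm T}) A : #|g @: A| = #|A|.
Proof. by rewrite card_imset //; apply: perm_inj. Qed.

Lemma perm_imsetC (g : {perm T}) A : g @: (~: A) = ~: (g @: A).
Proof.
apply/setP => x; rewrite -(permKV g x) inE !mem_imset ?inE //; exact: perm_inj.
Qed.

(* Meeting Jordan sets have a Jordan union, so a translate of a largest proper one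
   is equal to it, disjoint from it, or covers [T] together with it; hence it or
   its complement is a block. *)
Lemma primitive_jordan_set G A :
    (forall B, is_block G B -> 1 < #|B| -> B = setT) ->
    jordan_set G A -> 1 < #|A| -> #|A| < #|T| ->
  exists x, jordan_set G (~: [set x]).
Proof.
move=> prim JA A1 AT.
pose P B := [&& jordan_set G B, 1 < #|B| & #|B| < #|T|].
have PA : P A by rewrite /P JA A1.
case: (@arg_maxnP _ A P (fun B => #|B|) PA) => C /and3P[JC C1 CT] maxC.
have dich g : g \in G -> [\/ g @: C = C, [disjoint g @: C & C] | C :|: g @: C = setT].
  move=> gG; have [->|neC] := eqVneq (g @: C) C; first by constructor 1.
  have [/pred0P d|/pred0Pn[w /=/andP[wg wC]]] := boolP [disjoint g @: C & C].
    by constructor 2.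
  constructor 3; apply/eqP; rewrite eqEcard subsetT cardsT leqNgt /=; apply/negP => lt.
  have JU := jordan_setU wC wg JC (jordan_setJ gG JC).
  have /maxC leU : P (C :|: g @: C).
    by rewrite /P JU lt andbT (leq_trans C1) // subset_leq_card // subsetUl.
  case/eqP: neC; apply/eqP; rewrite eqEcard card_imset_perm leqnn andbT.
  have : C == C :|: g @: C by rewrite eqEcard subsetUl; exact: leU.
  by move/eqP => E; rewrite {2}E subsetUr.
have cardC := cardsC C.
(* If [C] has at most half of the points, a translate covering [T] together with [C] is disjoint
   from it, so [C] is a block. *)
have [small|big] := leqP (#|C|.*2) #|T|.
  suff /prim/(_ C1) E : is_block G C by move: CT; rewrite E cardsT ltnn.
  apply/is_blockP => g x gG xC gxC; case: (dich g gG) => // [/pred0P/(_ (g x))|U].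
    by rewrite /= gxC imset_f.
  have : #|C :&: g @: C| > 0 by apply/card_gt0P; exists (g x); rewrite inE gxC imset_f.
  have := cardsUI C (g @: C); rewrite U cardsT card_imset_perm => *; lia.
have [/eqP/cards1P[x E]|C'1] := eqVneq #|~: C| 1%N.
  by exists x; rewrite -E setCK.
(* Now [C] is too large to have a disjoint translate, and a point outside [C] and [g @: C] excludes
   a covering. *)
have bC' : is_block G (~: C).
  apply/is_blockP => g x gG; rewrite perm_imsetC !inE => xC gxC.
  case: (dich g gG) => [->//|d|/setP/(_ (g x))].
    have := cardsU C (g @: C); rewrite setIC disjoint_setI0 // cards0 card_imset_perm.
    by have := subset_leq_card (subsetT (C :|: g @: C)); rewrite cardsT => *; lia.
  by rewrite !inE mem_imset ?(negPf xC) ?(negPf gxC) //; exact: perm_inj.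
have /(congr1 (@setC T)) : ~: C = setT by apply: prim => //; lia.
by rewrite setCK setCT => E; move: C1; rewrite E cards0.
Qed.

Lemma jordan_set_setC1 G x :
    (forall x y, exists2 g, g \in G & g x = y) ->
  jordan_set G (~: [set x]) -> forall y, jordan_set G (~: [set y]).
Proof.
move=> trG Jx y; have [g gG <-] := trG x y.
by have := jordan_setJ gG Jx; rewrite perm_imsetC imset_set1.
Qed.

End PermutationGroups.

Section ThreeCycles.
Local Open Scope group_scope.
Variable T : finType.
Implicit Types (A B C : {set T}) (G : {group {perm T}}) (x y z w : T).

(* Each of the [#|A|.-1 ^ 2] bad conditions [g u = v] holds for a proportion
   [1 / #|T|.-1] of the stabiliser of [x]. *)
Lemma exists_imset_setI1 G A x :
    jordan_set G (~: [set x]) -> x \in A -> (#|A|.-1 ^ 2 < #|T|.-1)%N ->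
  exists g, [/\ g \in G, g x = x & (g @: A) :&: A = [set x]].
Proof.
move=> Jx xA ltA; pose H := [set g in G | g x == x].
pose N u v := [set g in H | g u == v].
have N_const u v v' : v != x -> v' != x -> #|N u v| = #|N u v'|.
  wlog suff: v v' / v != x -> v' != x -> #|N u v| <= #|N u v'|.
    by move=> W vx v'x; apply/eqP; rewrite eqn_leq !W.
  move=> vx v'x; have [||h [hG hx hv]] := jordan_setP _ _ Jx v v'; rewrite ?inE //.
  rewrite -(card_imset _ (mulIg h));
    apply/subset_leq_card/subsetP => _ /imsetP[g gN ->].
  move: gN; rewrite !inE => /andP[/andP[gG /eqP gx] /eqP gu].
  by rewrite groupM // !permM gx gu hv eqxx (out_perm hx) ?eqxx // !inE eqxx.
have cardN u v : u != x -> v != x -> (#|N u v| * #|T|.-1)%N = #|H|.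
  move=> ux vx.
  rewrite -[RHS]sum1_card (partition_big (fun g : {perm T} => g u) (fun v' => v' !=
    x)) /=; last first.
    by move=> g; rewrite inE => /andP[_ /eqP gx];
      rewrite -[X in _ != X]gx (inj_eq perm_inj).
  rewrite (eq_bigr (fun=> #|N u v|)) => [|v' v'x].
    by rewrite sum_nat_const (cardC1 x) mulnC.
  by rewrite (N_const u v v') // -sum1_card; apply: eq_bigl => g; rewrite !inE.
have [|noB] := boolP [exists g in H, (g @: A) :&: A == [set x]].
  by case/exists_inP=> g; rewrite inE => /andP[gG /eqP gx] /eqP E; exists g.
have cov :
    H \subset \bigcup_(u in A :\ x) \bigcup_(v in A :\ x) N u v.
  apply/subsetP => g gH; move/exists_inPn: noB => /(_ g gH).
  have /andP[gG /eqP gx] : (g \in G) && (g x == x) by rewrite inE in gH.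
  rewrite eqEsubset andbC sub1set inE xA -{1}gx mem_imset ?xA //=; last exact: perm_inj.
  case/subsetPn => v; rewrite !inE => /andP[/imsetP[u uA ->] guA] gux.
  apply/bigcupP; exists u; first by rewrite !inE uA andbT;
    apply: contraNneq gux => ->; rewrite gx.
  by apply/bigcupP; exists (g u); rewrite !inE ?gux ?guA // gG gx !eqxx.
have H0 : #|H| > 0 by apply/card_gt0P; exists 1; rewrite inE group1 perm1 eqxx.
have cA : #|A|.-1 = #|A :\ x| by rewrite (cardsD1 x A) xA.
have : (#|H| * #|T|.-1 <= #|A|.-1 ^ 2 * #|H|)%N.
  apply: leq_trans (_ : #|\bigcup_(u in A :\ x) \bigcup_(v in A :\ x) N u v| * #|T|.-1
    <= _)%N.
    by rewrite leq_mul2r subset_leq_card ?orbT.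
  apply: leq_trans (_ : (\sum_(u in A :\ x) \sum_(v in A :\ x) #|N u v|) * #|T|.-1 <=
    _)%N.
    rewrite leq_mul2r; apply/orP; right.
    elim/big_rec2: _ => [|u m B _ le]; first by rewrite cards0.
    apply: leq_trans (leq_card_setU _ _) _; rewrite leq_add // {le}.
    elim/big_rec2: _ => [|v m' B' _ le]; first by rewrite cards0.
    by apply: leq_trans (leq_card_setU _ _) _; rewrite leq_add.
  rewrite big_distrl /= cA (eq_bigr (fun=> #|A :\ x| * #|H|)%N) ?sum_nat_const ?mulnA
    ?mulnn //.
  move=> u; rewrite !inE => /andP[ux _]; rewrite big_distrl /=.
  rewrite (eq_bigr (fun=> #|H|)) ?sum_nat_const //.
  by move=> v; rewrite !inE => /andP[vx _]; apply: cardN.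
by rewrite mulnC leq_mul2r eqn0Ngt H0 /= leqNgt ltA.
Qed.

(* The 3-cycle x -> y -> z -> x (permutations act on the right). *)
Definition cycle3 x y z : {perm T} := tperm x y * tperm x z.

Lemma cycle3J x y z (g : {perm T}) :
  cycle3 x y z ^ g = cycle3 (g x) (g y) (g z).
Proof. by rewrite conjMg !tpermJ. Qed.

Lemma cycle3E x y z w : x != y -> x != z -> y != z ->
  cycle3 x y z w = if w == x then y else if w == y then z else if w == z then x else w.
Proof.
move=> xy xz yz; rewrite permM.
have [->|wx] := eqVneq w x; first by rewrite tpermL tpermD // eq_sym.
have [->|wy] := eqVneq w y; first by rewrite tpermR tpermL.
rewrite [tperm x y w]tpermD 1?eq_sym //.
have [->|wz] := eqVneq w z; first by rewrite tpermR.
by rewrite tpermD 1?eq_sym.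
Qed.

Lemma cycle3_rot x y z : x != y -> x != z -> y != z -> cycle3 x y z = cycle3 y z x.
Proof.
move=> xy xz yz; have [yx zx] : y != x /\ z != x by rewrite eq_sym xy eq_sym xz.
apply/permP => w; rewrite !cycle3E //.
have [->|//] := eqVneq w x.
by rewrite (negPf xy) (negPf xz).
Qed.

Lemma cycle3V x y z : (cycle3 x y z)^-1 = cycle3 x z y.
Proof. by rewrite invMg !tpermV. Qed.

(** No point other than [x] is moved by both permutations, so they commute except around [x];
    following [x], [t x] and [s x] through the commutator gives the 3-cycle. *)
Lemma commg_cycle3 (s t : {perm T}) A B x : perm_on A s -> perm_on B t ->
  B :&: A = [set x] -> s x != x -> t x != x -> [~ s, t] = cycle3 x (t x) (s x).
Proof.
move=> sA tB BA sx tx.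
have Bx y : y \in A -> y != x -> y \notin B.
  by move=> yA; apply: contraNN => yB; rewrite -in_set1 -BA inE yA yB.
have [xB xA] : x \in B /\ x \in A by apply/andP; rewrite -in_setI BA inE.
have sxA : s x \in A by rewrite perm_closed.
have txB : t x \in B by rewrite perm_closed.
have fs y : y \in B -> y != x -> s y = y.
  by move=> yB yx; apply: (out_perm sA); apply: contraTN yB => yA; exact: Bx.
have ft y : y \in A -> y != x -> t y = y.
  by move=> yA yx; apply: (out_perm tB); apply: Bx.
have fV (r : {perm T}) y : r y = y -> r^-1 y = y by move=> E; rewrite -{1}E permK.
have VA y : y \in A -> s^-1 y \in A by rewrite perm_closed // perm_onV.
have stx : t x != s x by apply: contraTneq txB => ->; apply: Bx.
apply/permP => y; rewrite cycle3E // 1?eq_sym //.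
rewrite /commg /conjg !permM.
have [->|yx] := eqVneq y x.
  have nx : s^-1 x != x by apply: contraNneq sx => E; rewrite -{1}E permKV.
  by rewrite (fV t _ (ft _ (VA _ xA) nx)) permKV.
have [->|yt] := eqVneq y (t x).
  by rewrite (fV s _ (fs _ txB tx)) permK ft.
have [->|ys] := eqVneq y (s x).
  rewrite permK (fs (t^-1 x)) ?permKV //; first by rewrite perm_closed ?perm_onV.
  by apply: contraNneq tx => E; rewrite -{1}E permKV.
have [yA|yA] := boolP (y \in A).
  have nx : s^-1 y != x by apply: contraNneq ys => E; rewrite -E permKV.
  by rewrite (fV t _ (ft _ (VA _ yA) nx)) permKV ft.
rewrite (fV s _ (out_perm sA yA)).
have [yB|yB] := boolP (y \in B);
  last by rewrite (fV t _ (out_perm tB yB)) (out_perm sA) ?(out_perm tB).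
rewrite (fs (t^-1 y)) ?permKV //; first by rewrite perm_closed ?perm_onV.
by apply: contraNneq yt => E; rewrite -E permKV.
Qed.

(** By 2-transitivity [G] contains some (u v w1) for any [u != v], with no control over [w1].
    Conjugation by a 3-cycle (w1 w2 w3) of [G] then replaces [w1] by [w2]. *)
Lemma mem_all_cycle3 G x y z :
    (forall x y, exists2 g, g \in G & g x = y) ->
    (forall x, jordan_set G (~: [set x])) ->
    x != y -> x != z -> y != z -> cycle3 x y z \in G ->
  forall x' y' z', x' != y' -> x' != z' -> y' != z' -> cycle3 x' y' z' \in G.
Proof.
move=> trG JG xy xz yz xyzG.
have ex3 u v : u != v -> exists w, [/\ w != u, w != v & cycle3 u v w \in G].
  move=> uv; have [g gG gx] := trG x u.
  have gyu : g y != u by rewrite -gx (inj_eq perm_inj) eq_sym.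
  have [||h [hG hu hv]] := jordan_setP _ _ (JG u) (g y) v; rewrite ?inE // 1?eq_sym //.
  have hu' : h u = u by rewrite (out_perm hu) // !inE eqxx.
  exists (h (g z)); split.
  - by rewrite -[X in _ != X]hu' (inj_eq perm_inj) -gx (inj_eq perm_inj) eq_sym.
  - by rewrite -hv !(inj_eq perm_inj) eq_sym.
  by move: (groupJ (groupJ xyzG gG) hG); rewrite !cycle3J gx hu' hv.
move=> u v w2 uv uw2 vw2; have [w1 [w1u w1v uvw1]] := ex3 u v uv.
have [<-//|w12] := eqVneq w1 w2.
have [w3 [w31 w32 tG]] := ex3 w1 w2 w12.
have [w2u w2v] : w2 != u /\ w2 != v by rewrite eq_sym uw2 eq_sym vw2.
have [w21 w13] : w2 != w1 /\ w1 != w3 by rewrite eq_sym w12 eq_sym w31.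
have [vu w23] : v != u /\ w2 != w3 by rewrite eq_sym uv eq_sym w32.
have [uw1 vw1] : u != w1 /\ v != w1 by rewrite eq_sym w1u eq_sym w1v.
(* If [w3] is [u] or [v], that point would move too; conjugating by the inverse 3-cycle and
   inverting the result gives the target instead. *)
have [E|w3u] := eqVneq w3 u.
  move: (groupVr (groupJ uvw1 (groupVr tG)));
    rewrite cycle3V cycle3J cycle3V !cycle3E // E.
  by rewrite !eqxx (negPf uw1) (negPf vw1) (negPf vu) (negPf vw2) (@cycle3_rot w2).
have [E|w3v] := eqVneq w3 v.
  move: (groupVr (groupJ uvw1 (groupVr tG)));
    rewrite cycle3V cycle3J cycle3V !cycle3E // E.
  by rewrite !eqxx (negPf uw1) (negPf vw1) (negPf uv) (negPf uw2).
move: (groupJ uvw1 tG); rewrite cycle3J !cycle3E // !eqxx.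
rewrite (negPf uw1) (negPf vw1) (negPf uw2) (negPf vw2).
by rewrite eq_sym (negPf w3u) eq_sym (negPf w3v).
Qed.

(** An even permutation is a product of pairs of transpositions. A pair sharing a point is trivial
    or a 3-cycle, and inserting (x z)(x z) reduces (x y)(z w) to such pairs. *)
Lemma sub_Alt_cycle3 G :
    (forall x y z, x != y -> x != z -> y != z -> cycle3 x y z \in G) ->
  'Alt_T \subset G.
Proof.
move=> G3.
have G2 x y z w : x != y -> z != w -> tperm x y * tperm z w \in G.
  move=> xy zw.
  have G3' a b c : a != b -> a != c -> tperm a b * tperm a c \in G.
    by move=> ab ac; have [->|bc] := eqVneq b c; [rewrite tperm2 group1 | exact: G3].
  have [xz|xz] := eqVneq x z; first by rewrite -xz in zw *; exact: G3'.
  rewrite -(mulgK (tperm x z) (tperm x y)) tpermV -mulgA groupM ?G3' //.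
  by rewrite [tperm x z]tpermC G3' // eq_sym.
apply/subsetP => s; rewrite Alt_even; have [ts -> dts] := prod_tpermP s.
rewrite odd_perm_prod //.
have [m] := ubnP (size ts); elim: m ts dts => // m IH [|[x y] [|[z w] ts]] //=.
  by rewrite big_nil group1.
move=> /and3P[xy zw dts] le ev; rewrite !big_cons mulgA groupM ?G2 // IH //; first lia.
by rewrite negbK in ev.
Qed.


End ThreeCycles.

(** * Primitivity from a cycle type *)

Section PrimitiveGroups.
Local Open Scope group_scope.
Variable T : finType.
Implicit Types (A B C : {set T}) (G : {group {perm T}}) (x y w : T).

(** The Jordan set gives 2-transitivity, and its size a [g] fixing [x] such that [g @: A] meets [A]
    only in [x]. If [s] is supported in [A] and moves [x], the commutator of [s] and [s ^ g] is a
    3-cycle. *)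
Lemma primitive_Alt_sub G A :
    (forall x y, exists2 g, g \in G & g x = y) ->
    (forall B, is_block G B -> 1 < #|B| -> B = setT) ->
    jordan_set G A -> 1 < #|A| -> (#|A|.-1 ^ 2 < #|T|.-1)%N ->
  'Alt_T \subset G.
Proof.
move=> trG prim JA A1 AT.
have ltAT : #|A| < #|T| by case: #|A| A1 AT => // -[//|a] _ /=; nia.
have [x0 Jx0] := primitive_jordan_set prim JA A1 ltAT.
have JG := jordan_set_setC1 trG Jx0.
have [x [y [xA yA xy]]] := card_gt1P A1.
have [s [sG sA sx]] := jordan_setP _ _ JA x y xA yA.
have [g [gG gx gA]] := exists_imset_setI1 (JG x) xA AT.
have sgx : (s ^ g) x = g y by rewrite -[X in (s ^ g) X]gx permJ sx.
have gyx : g y != x by rewrite -gx (inj_eq perm_inj) eq_sym.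
have gyA : g y \notin A.
  apply: contra gyx => gyA; rewrite -in_set1 -gA inE gyA andbT imset_f //.
have yx : y != x by rewrite eq_sym.
have := groupR sG (groupJ sG gG).
rewrite (commg_cycle3 sA (perm_onJ g sA) gA) ?sx ?sgx // => c3G.
apply: sub_Alt_cycle3; apply: mem_all_cycle3 c3G => //; first by rewrite eq_sym.
by apply: contraNneq gyA => ->.
Qed.

Lemma permX_mul_porbit (z : {perm T}) x i : (z ^+ (#|porbit z x| * i)) x = x.
Proof. by rewrite expgM permX_fix // permX iter_porbit. Qed.

Lemma porbitX_dvdn (z : {perm T}) x i : (z ^+ i) x = x -> #|porbit z x| %| i.
Proof.
move=> zi; rewrite /dvdn; set l := #|porbit z x|.
have l0 : 0 < l by rewrite lt0n card_porbit_neq0.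
have zil : (z ^+ (i %% l)) x = x.
  by rewrite -[RHS]zi {2}(divn_eq i l) mulnC expgD permM permX_mul_porbit.
have := @nth_uniq _ x (traject z x l) (i %% l) 0.
rewrite size_traject ltn_pmod // uniq_traject_porbit => /(_ isT l0 isT) <-.
by rewrite !nth_traject ?ltn_pmod // -permX zil.
Qed.

Lemma porbit_sub_closed (z : {perm T}) B x :
  {in B, forall y, z y \in B} -> x \in B -> porbit z x \subset B.
Proof.
move=> zB xB; apply/subsetP => y /porbitP[i ->]; rewrite permX.
by elim: i => //= i IH; apply: zB.
Qed.

(** If [k] is the product of the other cycle lengths, [z ^+ k] fixes every point off this cycle and,
    [k] being prime to its length, has powers transitive on it. *)
Lemma jordan_set_porbit G (z : {perm T}) x :
    z \in G -> (forall w, w \notin porbit z x -> coprime #|porbit z x| #|porbit z w|) ->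
  jordan_set G (porbit z x).
Proof.
move=> zG cop; pose k := (\prod_(X in porbits z :\ porbit z x) #|X|)%N.
have copk : coprime k #|porbit z x|.
  rewrite /k; elim/big_rec: _ => [|X m]; first by rewrite coprime1n.
  case/setD1P=> Xx /imsetP[w _ E] cm; rewrite {X}E eq_porbit_mem in Xx *.
  by rewrite coprimeMl cm andbT coprime_sym cop.
have zk w : w \notin porbit z x -> (z ^+ k) w = w.
  move=> xw; have wP : porbit z w \in porbits z :\ porbit z x.
    by rewrite !inE eq_porbit_mem xw imset_f.
  by rewrite /k (big_setD1 _ wP) permX_mul_porbit.
have zkA : perm_on (porbit z x) (z ^+ k).
  by apply/subsetP => w; rewrite inE; apply: contraNT => /zk->.
have zkX i : perm_on (porbit z x) ((z ^+ k) ^+ i).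
  by elim: i => [|i IH]; rewrite ?expg0 ?perm_on1 // expgS perm_onM.
set a := #|porbit z x| in copk.
have a0 : 0 < a by rewrite lt0n card_porbit_neq0.
apply/jordan_setP => u v; rewrite -eq_porbit_mem => /eqP Eu vA.
move: (vA); rewrite -Eu => /porbitP[i ->].
have zau j : (z ^+ (a * j)) u = u by rewrite /a -Eu permX_mul_porbit.
(* The total exponent of [z] is a multiple of [k] congruent to [i] modulo the cycle length, so this
   power acts at [u] as [z ^+ i]. *)
exists ((z ^+ k) ^+ (chinese a k i 0 %/ k)); split; first by rewrite !groupX.
- by rewrite Eu; apply: zkX.
have ca : coprime a k by rewrite coprime_sym.
have dvk : k %| chinese a k i 0.
  by rewrite /dvdn (chinese_modr ca i 0) mod0n.
rewrite -expgM mulnC divnK // (divn_eq (chinese _ _ _ _) a) mulnC expgD permM zau.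
by rewrite chinese_modl // [in RHS](divn_eq i a) [in RHS]mulnC expgD permM zau.
Qed.

(** The translates of [B] lying in [A] partition it: they cover [A] because [G] is transitive and a
    translate meeting [A] lies in it. *)
Lemma block_dvdn G B A :
    (forall x y, exists2 g, g \in G & g x = y) -> is_block G B -> B != set0 ->
    (forall g, g \in G -> g @: B :&: A != set0 -> g @: B \subset A) ->
  #|B| %| #|A|.
Proof.
move=> trG /is_blockP bB /set0Pn[b bB0] subA.
pose P := [set C : {set T} in [set (g : {perm T}) @: B | g in G] | C \subset A].
have PA : partition P A.
  apply/and3P; split.
  - apply/eqP/setP => x; apply/bigcupP/idP => [[C]|xA].
      by rewrite inE => /andP[_ /subsetP CA] /CA.
    have [g gG gb] := trG b x.
    have xB : x \in g @: B by rewrite -gb imset_f.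
    exists (g @: B) => //; rewrite inE imset_f //= subA //.
    by apply/set0Pn; exists x; rewrite inE xB.
  - apply/trivIsetP => _ _ /setIdP[/imsetP[g gG ->] _] /setIdP[/imsetP[h hG ->] _].
    apply: contraR => /pred0Pn[x /= /andP[/imsetP[u uB ->] /imsetP[v vB E]]].
    have /(_ (g * h^-1) u) E2 := bB; move: E2; rewrite permM E permK.
    move=> /(_ (groupM gG (groupVr hG)) uB vB) E2; apply/eqP.
    rewrite -[in RHS]E2 -imset_comp; apply: eq_imset => y /=.
    by rewrite permM permKV.
  - rewrite inE; apply/nandP; left; apply/imsetP => -[g gG E].
    by have := imset_f g bB0; rewrite -E inE.
have PB : {in P, forall C, #|C| = #|B|}.
  by move=> C /setIdP[/imsetP[g _ ->] _]; apply: card_imset_perm.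
by rewrite (card_uniform_partition PB PA) dvdn_mull.
Qed.

Lemma block_imset G B g : g \in G -> is_block G B -> is_block G (g @: B).
Proof.
move=> gG /is_blockP bB; apply/is_blockP => h _ hG /imsetP[x xB ->] /imsetP[y yB E].
have E2 : (h ^ g^-1) @: B = B.
  apply: (bB _ x); rewrite ?groupJ ?groupV //.
  by rewrite conjgE invgK !permM E permK.
rewrite -[in RHS]E2 -!imset_comp; apply: eq_imset => w /=.
by rewrite conjgE invgK !permM permKV.
Qed.

(** A proper block with more than one point that meets the cycle of [x] lies in it. So its size
    divides that cycle length and, by coprimality, no other. Hence some translate meets two other
    cycles, which the condition on [i * #|porbit z w|] forbids. *)
Lemma primitive_porbit G (z : {perm T}) x :
    (forall x y, exists2 g, g \in G & g x = y) ->
    z \in G -> porbit z x != setT ->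
    (forall w, w \notin porbit z x -> coprime #|porbit z x| #|porbit z w|) ->
    (forall w w' i, w \notin porbit z x -> w' \notin porbit z x ->
       w' \notin porbit z w -> 0 < i <= #|porbit z x| ->
       ~~ (#|porbit z w'| %| i * #|porbit z w|)) ->
    (forall B, z @: B = B -> porbit z x \proper B -> B != setT ->
       ~~ (#|B| %| #|T|)) ->
  forall B, is_block G B -> 1 < #|B| -> B = setT.
Proof.
move=> trG zG AT cop far ndv.
have JA := jordan_set_porbit zG cop; set A := porbit z x in AT cop far ndv JA *.
have zA w : (z w \in A) = (w \in A).
  by rewrite -eq_porbit_mem -[in RHS]eq_porbit_mem -[z w]/((z ^+ 1) w) porbit_perm.
have dvT B : is_block G B -> 1 < #|B| -> #|B| %| #|T|.
  move=> bB B1; rewrite -cardsT; apply: (block_dvdn trG bB) => //.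
  by rewrite -card_gt0 ltnW.
(* A block that meets [A] and leaves it is preserved by the elements supported in [A], hence
   contains [A] and is invariant under [z]; then its size cannot divide [#|T|]. *)
have meetA B u : is_block G B -> 1 < #|B| -> B != setT -> u \in B -> u \in A -> B
  \subset A.
  move=> bB B1 BT uB uA; apply: contraT => /subsetPn[w wB wA].
  have AB : A \subset B.
    apply/subsetP => v vA; have [h [hG hA <-]] := jordan_setP _ _ JA u v uA vA.
    have <- : h @: B = B by apply: (is_blockP _ _ bB _ w) => //; rewrite (out_perm hA).
    exact: imset_f.
  have/negP[] : ~~ (#|B| %| #|T|); last exact: dvT.
  apply: ndv => //; first by apply: (is_blockP _ _ bB _ u) => //; apply: (subsetP AB);
    rewrite zA.
  by apply/properP; split=> //; exists w.
move=> B0 bB0 B01; apply/eqP; apply: contraT => B0T.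
have /card_gt0P[b bB] : 0 < #|B0| by apply: ltnW.
have [g gG gb] := trG b x.
pose B := g @: B0.
have cB (h : {perm T}) : #|h @: B| = #|B| by rewrite card_imset_perm.
have BE : #|B| = #|B0| by rewrite card_imset_perm.
have bB' h : h \in G -> is_block G (h @: B).
  by move=> hG; do 2!apply: block_imset => //.
have nT (h : {perm T}) : h @: B != setT.
  apply: contraNneq B0T => E; rewrite eqEcard subsetT -BE -(cB h) E cardsT; lia.
have B1 : 1 < #|B| by rewrite BE.
have bBB : is_block G B by apply: block_imset.
have B0' : B != set0 by rewrite -card_gt0 ltnW.
have dA : #|B| %| #|A|.
  apply: (block_dvdn trG bBB) => // h hG /set0Pn[u /setIP[uB uA]].
  by apply: (meetA _ u) => //; rewrite ?cB //; apply: bB'.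
have leBA : #|B| <= #|A| by apply: dvdn_leq => //; rewrite lt0n card_porbit_neq0.
have [w _ wA] : exists2 w, w \in setT & w \notin A.
  by apply/subsetPn; apply: contraNN AT; rewrite -subTset.
have/negP[] : ~~ (#|B| %| #|porbit z w|).
  apply: contraL (cop w wA) => dw; rewrite /coprime -/A.
  have : #|B| %| gcdn #|A| #|porbit z w| by rewrite dvdn_gcd dA.
  by case: eqP => // ->; rewrite dvdn1; lia.
apply: (block_dvdn trG bBB) => // h hG /set0Pn[u /setIP[uC uw]].
have uA : u \notin A.
  apply: contra wA => uA.
  by rewrite /A -eq_porbit_mem; move: uA uw; rewrite -!eq_porbit_mem => /eqP<- /eqP->.
apply/subsetP => w' w'C; apply: contraT => w'w.
have w'A : w' \notin A.
  apply: contra uA => w'A; apply: subsetP uC.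
  by apply: (meetA _ w') => //; rewrite ?cB //; apply: bB'.
set C := h @: B in uC w'C.
(* [t] fixes [u], hence preserves [C], which therefore contains the [t]-orbit of [w']. That orbit
   has at most [#|A|] points, and its length times [y] is a multiple of the length of the [z]-cycle
   of [w']. *)
pose y := #|porbit z w|; pose t := z ^+ y.
have tC : t @: C = C.
  apply: (is_blockP _ _ (bB' h hG) _ u); rewrite ?groupX //.
  suff -> : t u = u by [].
  move: uw; rewrite -eq_porbit_mem => /eqP uw.
  by rewrite /t /y -uw permX iter_porbit.
have tw'C : porbit t w' \subset C.
  by apply: porbit_sub_closed => // v vC; rewrite -tC imset_f.
have/negP[] : ~~ (#|porbit z w'| %| #|porbit t w'| * #|porbit z w|).
  apply: far => //; rewrite lt0n card_porbit_neq0 /=;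
    apply: leq_trans (subset_leq_card tw'C) _.
  by rewrite cB.
by apply: porbitX_dvdn; rewrite mulnC expgM permX iter_porbit.
Qed.

End PrimitiveGroups.

(** * Choice of the cycle lengths *)

Section Lengths.
Implicit Types (a b m n s : nat) (S : seq nat).

(** Each injective [f h] sends at most [size S] indices into [S], so at most [k * size S] indices
    are bad. *)
Lemma exists_avoiding S k N (f : 'I_k -> nat -> nat) :
    (forall h i j, i < N -> j < N -> f h i = f h j -> i = j) ->
    k * size S < N ->
  exists2 i, i < N & forall h, f h i \notin S.
Proof.
move=> injf ltN; pose H h := [set i : 'I_N | f h i \in S].
have cardH h : #|H h| <= size S.
  rewrite cardE -(size_map (fun i : 'I_N => f h i)); apply: uniq_leq_size.
    rewrite map_inj_in_uniq ?enum_uniq // => i j _ _ E; apply: val_inj.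
    exact: injf (ltn_ord i) (ltn_ord j) E.
  by move=> _ /mapP[i + ->]; rewrite mem_enum inE.
have [|cov] := boolP [exists i : 'I_N, [forall h, f h i \notin S]].
  by case/existsP=> i /forallP iS; exists i.
have : [set: 'I_N] \subset \bigcup_h H h.
  apply/subsetP => i _; move/existsPn: cov => /(_ i) /forallPn[h].
  by rewrite negbK => iS; apply/bigcupP; exists h; rewrite ?inE.
move/subset_leq_card; rewrite cardsT card_ord leqNgt => /negP[].
apply: leq_ltn_trans ltN; rewrite -[k in leqRHS]card_ord -sum_nat_const.
elim/big_rec2: _ => [|h m B _ le]; first by rewrite cards0.
by apply: leq_trans (leq_card_setU _ _) _; rewrite leq_add.
Qed.

(** Otherwise [y'] divides [m] times the difference of [y] and [y'], which is positive and smaller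
    than [y']. *)
Lemma near_not_dvdn a m y y' :
    y != y' -> a * (y' - y) < y -> a * (y - y') < y' -> 0 < m <= a ->
  ~~ (y' %| m * y).
Proof.
move=> ne lt lt' /andP[m0 ma]; apply/negP => dv.
have [le|le] := leqP y y'.
  have /dvdn_leq : y' %| m * (y' - y) by rewrite mulnBr (dvdn_sub _ dv) // dvdn_mull.
  rewrite muln_gt0 m0 subn_gt0 ltn_neqAle ne le => /(_ isT) le_m.
  by have := leq_ltn_trans (leq_trans le_m (leq_mul ma (leqnn _))) lt;
    rewrite ltnNge le.
have /dvdn_leq : y' %| m * (y - y') by rewrite mulnBr (dvdn_sub dv) // dvdn_mull.
rewrite muln_gt0 m0 subn_gt0 le => /(_ isT) le_m.
by have := leq_ltn_trans (leq_trans le_m (leq_mul ma (leqnn _))) lt'; lia.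
Qed.

Lemma not_dvdn_half d n : d < n -> n < 3 * d -> d != n %/ 2 -> ~~ (d %| n).
Proof. by move=> ? ?; apply: contra => /dvdnP[q ?]; have : q = 2 by [nia]; lia. Qed.

Lemma not_dvdn_third d n : d < n -> n < 4 * d -> 2 * d != n -> d != n %/ 3 -> ~~ (d %|
  n).
Proof.
move=> ? ? ? ?; apply/negP => /dvdnP[q ?].
have [?|?] : q = 2 \/ q = 3 by nia. all: lia.
Qed.

Lemma coprime_3X j y : y %% 3 != 0 -> coprime (3 ^ j) y.
Proof. by move=> y3; rewrite coprimeXl // prime_coprime. Qed.

(** There are [s.+1] candidates against at most [s] values; the bound on [n] keeps the truncated
    subtraction injective. *)
Lemma exists_3X_avoiding S n s : size S <= s -> 3 ^ s.+1 <= n ->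
  exists2 j, 0 < j <= s.+1 & n - 3 ^ j \notin S.
Proof.
move=> leS le_n; have mono i : i < s.+1 -> 3 ^ i.+1 <= n.
  by move=> lt; apply: leq_trans le_n; rewrite leq_exp2l.
have [||i lt /(_ ord0) iS] := @exists_avoiding S 1 s.+1 (fun _ i => n - 3 ^ i.+1).
- move=> _ i j /mono li /mono lj E; have : 3 ^ i.+1 = 3 ^ j.+1 by lia.
  by move/eqP; rewrite eqn_exp2l // => /eqP; lia.
- by rewrite mul1n.
by exists i.+1.
Qed.

(** Here [a] is a power of 3 and [b] runs through a progression of step 3 just below half of
    [n - a]. Its [2 * s + 3] terms suffice for [b] and [r] both to avoid [s.+1] values. *)
Lemma two_lengths s : exists n0, forall n (S : seq nat), n0 <= n -> size S <= s ->
  exists a b r, [/\ a + b + r = n, 1 < a /\ a ^ 2 < n.-1,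
    coprime a b && coprime a r,
    [/\ b != r, a * (b - r) < r & a * (r - b) < b] &
    [/\ b \notin S, r \notin S & b + r \notin S] /\
    ~~ (a + b %| n) && ~~ (a + r %| n)].
Proof.
(* [M] bounds [a], and [K] the linear expressions in [s] by which [a] gets multiplied, so [n]
   exceeds all these products. *)
pose M := 3 ^ s.+1; pose K := 100 * (s + 10) + M;
  exists (100 * (M * K)) => n S le_n leS.
have M0 : 0 < M by rewrite expn_gt0.
have KM : K <= M * K by rewrite leq_pmull.
have MK : M <= K by rewrite leq_addl.
have sK : 100 * s + 1000 <= K by rewrite /K; lia.
have [j /andP[j0 js] aS] := @exists_3X_avoiding S n s leS ltac:(lia).
set a := 3 ^ j in aS.
have aM : a <= M by rewrite leq_exp2l.
have a3 : exists a', a = 3 * a' by exists (3 ^ j.-1); rewrite -expnS prednK.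
have aK d : d <= K -> a * d <= M * K by move=> ?; apply: leq_mul.
have a2 : 1 < a by rewrite -(expn0 3) ltn_exp2l.
have aa := aK a ltac:(lia).
have a1 := aK (3 * (2 * s + 10) * 3) ltac:(lia).
clearbody M K; set m := (n - a) %/ 2.
(* With this residue for [b], that of [r], namely [n - rho], is nonzero as well, because 3 divides
   [a]. *)
pose rho := if n %% 3 == 1 then 2 else 1.
(* The offset keeps the whole progression below [m], so [b < r], with a difference bounded in terms
   of [s]. *)
pose b0 := m - 3 * (2 * s + 10) - (m - 3 * (2 * s + 10)) %% 3 + rho.
have b03 : b0 %% 3 = rho by rewrite /b0 /rho; case: ifP => _; lia.
have rho2 : (rho = 2 /\ n %% 3 = 1) \/ (rho = 1 /\ n %% 3 != 1).
  by rewrite /rho; case: eqP; [left|right].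
have b0m : b0 <= m - 3 * (2 * s + 10) + 2 /\ m - 3 * (2 * s + 10) - 2 <= b0.
  by rewrite /b0; lia.
clearbody rho b0.
(* [2 (a + b) = n] is the only way for [a + b] to divide [n]. *)
pose f (h : 'I_2) i := if h == ord0 then b0 + 3 * i else n - a - (b0 + 3 * i).
have [||i lt iS] := @exists_avoiding (n %/ 2 - a :: S) 2 (2 * s + 3) f.
- by move=> h x y ltx lty; rewrite /f; case: ifP => _; lia.
- by rewrite /=; lia.
have := iS ord0; have := iS ord_max; rewrite /f /= !inE !negb_or.
set b := b0 + 3 * i; set r := n - a - b => /andP[_ rS] /andP[bn bS].
have abrn : a + b + r = n by rewrite /r /b; lia.
have rb : b < r /\ r <= b + 3 * (2 * s + 10) * 3 by rewrite /r /b; lia.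
have ar : a * (r - b) <= a * (3 * (2 * s + 10) * 3) by rewrite leq_mul2l; lia.
exists a, b, r; split=> //.
- by split=> //; rewrite -mulnn; lia.
- by rewrite !coprime_3X //; case: a3 => a' Ea; rewrite ?/b; lia.
- by split; [lia | rewrite (_ : b - r = 0) ?muln0; lia | lia].
split; first by split=> //; suff -> : b + r = n - a by []; lia.
by apply/andP; split; apply: not_dvdn_half; lia.
Qed.

(** The choice takes two rounds: [b] determines [c + r = n - a - b], and then [c] determines [r],
    [b + c] and [b + r]. *)
Lemma three_lengths s : exists n0, forall n (S : seq nat), n0 <= n -> size S <= s ->
  exists a b c r, [/\ a + b + c + r = n, 1 < a /\ a ^ 2 < n.-1,
    [/\ coprime a b, coprime a c & coprime a r],
    {in [:: b; c; r] &, forall y y', a * (y - y') < y'} /\ uniq [:: b; c; r] &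
    {in [:: b; c; r; b + c; b + r; c + r; b + c + r], forall y, y \notin S} /\
    {in [:: b; c; r; b + c; b + r; c + r], forall y, ~~ (a + y %| n)}].
Proof.
pose M := 3 ^ s.+1; pose K := 1000 * (s + 10) + M;
  exists (100 * (M * K)) => n S le_n leS.
have M0 : 0 < M by rewrite expn_gt0.
have KM : K <= M * K by rewrite leq_pmull.
have MK : M <= K by rewrite leq_addl.
have sK : 1000 * (s + 10) <= K by rewrite leq_addr.
clearbody K; have Mn : M <= n by clearbody M; lia.
have [j /andP[j0 js] aS] := exists_3X_avoiding leS Mn.
set a := 3 ^ j in aS.
have aM : a <= M by rewrite leq_exp2l.
have a3 : exists a', a = 3 * a' by exists (3 ^ j.-1); rewrite -expnS prednK.
have aK d : d <= K -> a * d <= M * K by move=> ?; apply: leq_mul.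
have a2 : 1 < a by rewrite -(expn0 3) ltn_exp2l.
have aa := aK a ltac:(lia).
clearbody M; set m := (n - a) %/ 3.
have mod3 p rho : rho < 3 -> exists2 q, p <= q < p + 3 & q %% 3 = rho.
  by move=> ?; exists (p + (rho + 2 * p) %% 3); lia.
have [b0 b0m b03] := mod3 m 1 isT.
have [c0 c0m c03] := mod3 m (if n %% 3 == 2 then 2 else 1) ltac:(case: ifP; lia).
pose f (h : 'I_2) i := if h == ord0 then b0 + 3 * i else n - a - (b0 + 3 * i).
have [||i lti iS] := @exists_avoiding (n %/ 3 - a :: S) 2 (2 * s + 3) f.
- by move=> h x y ltx lty; rewrite /f; case: ifP => _; lia.
- by rewrite /=; lia.
have := iS ord0; have := iS ord_max; rewrite /f /= !inE !negb_or.
have : (b0 + 3 * i) %% 3 = 1 by lia.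
have : m <= b0 + 3 * i <= m + 6 * s + 20 by lia.
move: (b0 + 3 * i) => b bm b3 /andP[_ b'S] /andP[bn bS].
clear f iS b0m b03 b0 lti i.
pose f (h : 'I_4) i := nth 0 [:: c0 + 3 * i; n - a - b - (c0 + 3 * i);
  b + (c0 + 3 * i); n - a - (c0 + 3 * i)] h.
(* The extra values prevent [3 * (a + y) = n], make [c] and [r] different from [b], and make [c]
   different from [r]. *)
have [||i lti iS] := @exists_avoiding [:: n %/ 3 - a, b, (n - a - b) %/ 2 & S]
  4 (4 * (s + 3) + 1) f.
- by move=> h x y ltx lty; rewrite /f; case: h => -[|[|[|[|h]]]] //= _; lia.
- by rewrite /=; lia.
have := iS ord_max; have := iS (inord 2); have := iS (inord 1); have := iS ord0.
rewrite /f !inordK // /= !inE !negb_or => {f iS}.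
have : (c0 + 3 * i) %% 3 = if n %% 3 == 2 then 2 else 1 by lia.
have : m <= c0 + 3 * i <= m + 12 * s + 100 by lia.
move: (c0 + 3 * i) bn bS => c + + cm c3 {c0m c03 c0 lti i}.
have abcn : a + b + c <= n by lia.
pose r := n - a - b - c; rewrite -/r.
have abcrn : a + b + c + r = n by rewrite /r; clear -abcn; lia.
have bcr : n - a = b + c + r by lia.
have br : n - a - c = b + r by lia.
have cr' : n - a - b = c + r by lia.
have a1 := aK (30 * s + 300) ltac:(lia).
have a0 : a %% 3 = 0 by case: a3 => a' ->; rewrite modnMr.
have r3 : r %% 3 != 0 by move: c3; case: ifP; lia.
have rm : m <= r + 18 * s + 200 /\ r <= m + 2 by lia.
rewrite bcr in aS; rewrite br cr' in b'S *.
clearbody r.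
pose near y := m <= y + 18 * s + 200 /\ y <= m + 12 * s + 100.
have [near_b near_c near_r] : [/\ near b, near c & near r] by rewrite /near; split; lia.
have m0 : n <= 3 * m + a + 2 /\ 3 * m + a <= n by lia.
have c3' : c %% 3 != 0 by move: c3; case: ifP; lia.
have big : a + 10 * (18 * s + 300) < m by lia.
have near_lt y y' : near y -> near y' -> a * (y - y') < y'.
  move=> [y1 y2] [y'1 y'2]; apply: (@leq_ltn_trans (a * (30 * s + 300))); last lia.
  by rewrite leq_mul2l; lia.
(* [a + y] is close to a third of [n], and [a + (y + y')] to two thirds, so a third of [n] is the
   only divisor to exclude. *)
have third y : near y -> y != n %/ 3 - a -> ~~ (a + y %| n).
  by move=> [y1 y2] yn; apply: not_dvdn_third; lia.
have half y y' : near y -> near y' -> y + y' < n - a -> ~~ (a + (y + y') %| n).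
  by move=> [y1 y2] [y'1 y'2] yy; apply: not_dvdn_half; lia.
have bcr_gt0 : [/\ 0 < b, 0 < c & 0 < r] by rewrite /near in near_b near_c near_r;
  split; lia.
have a2n : a ^ 2 < n.-1 by rewrite -mulnn; lia.
move=> bn bS /and4P[cn cb cr cS] /and4P[rn rb _ rS] /and4P[_ _ _ bcS] /and4P[_ _ _ brS].
have {cr}r_c : c != r by apply: contraNneq cr => <-; rewrite addnn -muln2 mulnK.
exists a, b, c, r; split=> //.
- by split; apply: coprime_3X => //; rewrite b3.
- split; first by move=> y y'; rewrite !inE => /or3P[]/eqP-> /or3P[]/eqP->;
  apply: near_lt.
  by rewrite /= !inE !negb_or r_c 1?eq_sym cb eq_sym rb.
split.
  by apply/allP; rewrite /= bS cS rS bcS brS b'S aS.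
apply/allP; rewrite /= andbT (third b) // (third c) // (third r) // !half // bcr;
  case: bcr_gt0; clear; lia.
Qed.

End Lengths.

Section Admissible.

(* [l ord0] is the length of the short cycle. The fourth condition prevents a
   block of size at most [l ord0] from meeting two of the other cycles, the last
   one prevents a block from being a union of the short cycle and some others;
   sums over sets without [ord0] are sizes of invariant sets up to complement. *)
Definition admissible n (S : seq nat) k (l : 'I_k.+1 -> nat) : Prop :=
  [/\ \sum_i l i = n /\ (forall i, 0 < l i),
      1 < l ord0 /\ (l ord0).-1 ^ 2 < n.-1,
      forall i, i != ord0 -> coprime (l ord0) (l i),
      forall i j m, i != ord0 -> j != ord0 -> i != j -> 0 < m <= l ord0 ->
        ~~ (l j %| m * l i) &
      (forall I : {set 'I_k.+1}, ord0 \notin I ->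
         0 < \sum_(i in I) l i -> \sum_(i in I) l i \notin S) /\
      (forall I : {set 'I_k.+1}, ord0 \in I ->
         l ord0 < \sum_(i in I) l i < n -> ~~ (\sum_(i in I) l i %| n))].

Lemma exists_admissible k s : k = 2 \/ k = 3 ->
  exists n0, forall n (S : seq nat), n0 <= n -> size S <= s ->
    exists l : 'I_k.+1 -> nat, admissible n S l.
Proof.
have ltpred a m : a ^ 2 < m -> a.-1 ^ 2 < m.
  by apply: leq_ltn_trans; rewrite leq_exp2r ?leq_pred.
have copgt0 a y : 1 < a -> coprime a y -> 0 < y.
  by case: y => // a1; rewrite /coprime gcdn0 => /eqP E; rewrite E in a1.
case=> ->.
  have [n0 H] := two_lengths s; exists n0 => n S le_n leS.
  have [a [b [r [abr [a1 a2] /andP[cb cr] [br brl rbl]]]]] := H n S le_n leS.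
  case=> -[bS rS brS] /andP[abn arn].
  have [b0 r0] := (copgt0 _ _ a1 cb, copgt0 _ _ a1 cr).
  exists (fun i => nth 0 [:: a; b; r] i); split.
  - split; first by rewrite !big_ord_recl big_ord0 /=; lia.
    by case=> [[|[|[|i]]]] //= _; lia.
  - by rewrite /= ltpred.
  - by case=> [[|[|[|i]]]].
  - have := near_not_dvdn br rbl brl.
    rewrite eq_sym in br; have := near_not_dvdn br brl rbl.
    move=> H1 H2 [[|[|[|i]]] Hi] [[|[|[|j]]] Hj] m //= _ _ _.
    + exact: H2.
    + exact: H1.
  split=> I; rewrite big_mkcond !big_ord_recl big_ord0 /= addn0.
    move/negPf->; do 2!case: ifP => _; rewrite ?addn0 ?add0n //.
  move=> ->; do 2!case: ifP => _; rewrite ?addn0 ?add0n //=; lia.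
have [n0 H] := three_lengths s; exists n0 => n S le_n leS.
have [a [b [c [r [abcr [a1 a2] [cb cc cr] [near uq] [nS ndv]]]]]] := H n S le_n leS.
have [b0 c0 r0] := And3 (copgt0 _ _ a1 cb) (copgt0 _ _ a1 cc) (copgt0 _ _ a1 cr).
exists (fun i => nth 0 [:: a; b; c; r] i); split.
- split; first by rewrite !big_ord_recl big_ord0 /=; lia.
  by case=> [[|[|[|[|i]]]]] //= _; lia.
- by rewrite /= ltpred.
- by case=> [[|[|[|[|i]]]]].
- move=> i j m i0 j0 ij.
  have mem (h : 'I_4) : h != ord0 -> nth 0 [:: a; b; c; r] h \in [:: b; c; r].
    by case: h => [[|[|[|[|h]]]]] //= _ _; rewrite !inE eqxx ?orbT.
  apply: near_not_dvdn; rewrite ?near ?mem //.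
  move: i0 j0 ij; case: i j => [[|[|[|[|i]]]] ?] [[|[|[|[|j]]]] ?] //= _ _ _;
    by move: uq; rewrite /= !inE !negb_or => /and3P[/andP[? ?] ? _]; rewrite // eq_sym.
split=> I; rewrite big_mkcond !big_ord_recl big_ord0 /= addn0.
  by move/negPf->; do 3!case: ifP => _; rewrite ?addn0 ?add0n // => _; apply: nS;
     rewrite !inE ?addnA ?eqxx ?orbT.
move=> ->; do 3!case: ifP => _; rewrite ?addn0 ?add0n //=; try lia;
  by move=> _; apply: ndv; rewrite !inE ?addnA eqxx ?orbT.
Qed.
End Admissible.

(** * The common neighbour *)

Section CycleType.
Local Open Scope group_scope.

Lemma iter_ordS n (j : 'I_n) m : val (iter m (@ordS n) j) = (j + m) %% n.
Proof.
elim: m => [|m IH] /=; first by rewrite addn0 modn_small.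
by rewrite IH addnS -addn1 -[in RHS]addn1 modnDml.
Qed.

(** [T] is identified with the disjoint union of the ['I_(l i)], on each of which [z] is the cyclic
    successor; [c] names the cycle of a point. *)
Lemma exists_cycle_type (T I : finType) (l : I -> nat) :
    (\sum_i l i)%N = #|T| ->
  exists (z : {perm T}) (c : T -> I),
    (forall x y, (y \in porbit z x) = (c y == c x)) /\
    (forall i, #|c @^-1: [set i]| = l i).
Proof.
move=> sum_l; pose U := {i : I & 'I_(l i)}.
have cardU : #|{: U}| = #|T|.
  by rewrite card_tagged sumnE big_map big_enum /= -sum_l; apply: eq_bigr => i _;
    rewrite card_ord.
pose f (x : T) : U := enum_val (cast_ord (esym cardU) (enum_rank x)).
pose g (u : U) : T := enum_val (cast_ord cardU (enum_rank u)).
have fK : cancel f g by move=> x; rewrite /g /f enum_valK cast_ordKV enum_rankK.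
have gK : cancel g f by move=> x; rewrite /g /f enum_valK cast_ordK enum_rankK.
pose next (u : U) : U := Tagged (fun i => 'I_(l i)) (ordS (tagged u)).
pose prev (u : U) : U := Tagged (fun i => 'I_(l i)) (ord_pred (tagged u)).
have nextK : cancel next prev by case=> i j; rewrite /next /prev /= ordSK.
have stepK : cancel (g \o next \o f) (g \o prev \o f).
  by move=> x /=; rewrite gK nextK fK.
pose z := perm (can_inj stepK); pose c x := tag (f x).
have fzX m x : f ((z ^+ m) x) =
    Tagged (fun i => 'I_(l i)) (iter m (@ordS _) (tagged (f x))).
  elim: m => [|m IH]; first by rewrite expg0 perm1 /=; case: (f x).
  by rewrite expgSr permM permE /= gK /next IH.
exists z, c; split=> [x y|i].
  apply/porbitP/eqP => [[m ->]|cyx]; first by rewrite /c fzX.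
  (* This is the difference of the two positions, with the cycle length added to keep it
     nonnegative. *)
  rewrite /c in cyx; exists (tagged (f y) + (l (c x) - tagged (f x)))%N.
  apply: (can_inj fK); rewrite fzX; move: cyx; rewrite /c.
  case: (f x) (f y) => i j [i' j'] /= E; case: _ / E j => j.
  congr (Tagged _ _); apply: val_inj => /=; rewrite iter_ordS.
  by rewrite addnCA (subnKC (ltnW (ltn_ord j))) modnDr modn_small.
have -> : c @^-1: [set i] = [set g (Tagged (fun i => 'I_(l i)) j) | j : 'I_(l i)].
  apply/setP => x; rewrite !inE; apply/eqP/imsetP => [<-|[j _ ->]];
    last by rewrite /c gK.
  by exists (tagged (f x)) => //; rewrite -[LHS]fK; congr g; rewrite /c; case: (f x).
rewrite card_imset ?card_ord // => j j' /(can_inj gK)/eqP.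
by rewrite eq_Tagged => /eqP.
Qed.
End CycleType.

(** * Sizes of invariant sets, and generation of the alternating group *)

Section InvariantSets.
Local Open Scope group_scope.
Variable T : finType.
Implicit Types (x y z : {perm T}) (B : {set T}).

(** Invariant sets are the unions of cycles. Repetitions are kept, so a bound on the number of
    cycles bounds the length of the list. *)
Definition invariant_sizes y : seq nat :=
  [seq #|cover Q| | Q : {set {set T}} <- enum (powerset (porbits y))].

Lemma size_invariant_sizes y : size (invariant_sizes y) = (2 ^ #|porbits y|)%N.
Proof. by rewrite size_map -cardE card_powerset. Qed.

Lemma porbit_sub_invariant y B u : y @: B = B -> u \in B -> porbit y u \subset B.
Proof. by move=> yB; apply: porbit_sub_closed => v vB; rewrite -yB imset_f. Qed.

Lemma invariant_sizesP y m :
  reflect (exists2 B : {set T}, y @: B = B & m = #|B|) (m \in invariant_sizes y).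
Proof.
apply: (iffP mapP) => [[Q + ->]|[B yB ->]].
  rewrite mem_enum inE => /subsetP sQ; exists (cover Q) => //.
  apply/eqP; rewrite eqEcard card_imset_perm leqnn andbT.
  apply/subsetP => _ /imsetP[v /bigcupP[X XQ vX] ->].
  apply/bigcupP; exists X => //; have /imsetP[u _ Xu] := sQ X XQ.
  by move: vX; rewrite Xu -!eq_porbit_mem -[y v]/((y ^+ 1) v) porbit_perm.
exists [set porbit y u | u in B].
  by rewrite mem_enum inE; apply/subsetP => _ /imsetP[u _ ->]; apply: imset_f.
congr #|pred_of_set _|; apply/setP => v; apply/idP/bigcupP => [vB|[_ /imsetP[u uB ->]]].
  by exists (porbit y v); rewrite ?imset_f ?porbit_id.
exact/subsetP/porbit_sub_invariant.
Qed.

Lemma invariant_sizesC y B : #|B| \in invariant_sizes y -> #|~: B| \in invariant_sizes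
  y.
Proof.
case/invariant_sizesP => C yC BC; apply/invariant_sizesP; exists (~: C).
  by rewrite perm_imsetC yC.
by have := cardsC B; have := cardsC C; rewrite BC; lia.
Qed.

Lemma imset_conj x g B : (x ^ g) @: B = B -> x @: (g^-1 @: B) = g^-1 @: B.
Proof.
move=> xB; rewrite -[in RHS]xB -!imset_comp; apply: eq_imset => u /=.
by rewrite !permM permK.
Qed.

(** An orbit of the generated group, moved back by [a] and by [b], gives invariant sets of [x] and
    of [z] of the same size. *)
Lemma gen2_transitive x z (a b : {perm T}) :
    (forall B : {set T}, z @: B = B -> 0 < #|B| < #|T| -> #|B| \notin invariant_sizes
      x) ->
  forall u v, exists2 g, g \in <<[set x ^ a; z ^ b]>> & g u = v.
Proof.
move=> avoid u v; set H := <<_>>.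
have xH : x ^ a \in H by rewrite mem_gen // !inE eqxx.
have zH : z ^ b \in H by rewrite mem_gen // !inE eqxx orbT.
pose B := [set g u | g : {perm T} in H].
have invB h : h \in H -> h @: B = B.
  move=> hH; apply/eqP; rewrite eqEcard card_imset_perm leqnn andbT.
  apply/subsetP => _ /imsetP[_ /imsetP[g gH ->] ->].
  by rewrite -permM imset_f // groupM.
have [/imsetP[g gH ->]|vB] := boolP (v \in B); first by exists g.
have : #|b^-1 @: B| \in invariant_sizes x.
  apply/invariant_sizesP; exists (a^-1 @: B); first exact/imset_conj/invB.
  by rewrite !card_imset_perm.
case/negPn/negP; apply: avoid; first exact/imset_conj/invB.
rewrite card_imset_perm; apply/andP; split.
  by apply/card_gt0P; exists u; rewrite -[X in X \in _](perm1 u) imset_f // group1.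
by rewrite -cardsT proper_card // properE subsetT; apply/subsetPn; exists v.
Qed.

(** The permutation [z] has cycle lengths [l] and is chosen before [x]. The set [B] will show that
    [x] and [z] are not conjugate. *)
Lemma admissible_Alt_sub n S k (l : 'I_k.+1 -> nat) :
    #|T| = n -> admissible n S l ->
  exists z, [/\ odd_perm z = odd n (+) odd k.+1, z != 1 &
    forall x, {subset invariant_sizes x <= S} ->
      (exists2 B : {set T}, z @: B = B & #|B| \notin invariant_sizes x) /\
      (forall a b, 'Alt_T \subset <<[set x ^ a; z ^ b]>>)].
Proof.
move=> cardT [[sum_l l_gt0] [l0 l0sq] cop far [avoidS ndv]].
have [|z [c [zE cE]]] := @exists_cycle_type T 'I_k.+1 l; first by rewrite sum_l.
have cardp w : #|porbit z w| = l (c w).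
  by rewrite -cE; apply: eq_card => y; rewrite zE !inE.
have exc i : exists w, c w = i.
  have /card_gt0P[w] : 0 < #|c @^-1: [set i]| by rewrite cE.
  by rewrite !inE => /eqP; exists w.
have cardB (B : {set T}) : z @: B = B -> #|B| = (\sum_(i in c @: B) l i)%N.
  move=> zB; rewrite -sum1_card (partition_big_imset c) /=;
    apply: eq_bigr => i /imsetP[w wB ->].
  rewrite -cE -sum1_card; apply: eq_bigl => y; rewrite !inE andb_idl //.
  by rewrite -zE; apply: subsetP; apply: porbit_sub_invariant.
have [w0 cw0] := exc ord0; have cardA : #|porbit z w0| = l ord0 by rewrite cardp cw0.
have zA : z @: porbit z w0 = porbit z w0.
  apply/eqP; rewrite eqEcard card_imset_perm leqnn andbT.
  apply/subsetP => _ /imsetP[v vA ->]; move: vA.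
  by rewrite -!eq_porbit_mem -[z v]/((z ^+ 1) v) porbit_perm.
have l0n : l ord0 < n by nia.
have ninA w : (w \notin porbit z w0) = (c w != ord0) by rewrite zE cw0.
have avoid x : {subset invariant_sizes x <= S} ->
    forall B : {set T}, z @: B = B -> 0 < #|B| < #|T| -> #|B| \notin invariant_sizes x.
  move=> sS.
  have avoid0 (B : {set T}) : z @: B = B -> 0 < #|B| -> w0 \notin B -> #|B| \notin
    invariant_sizes x.
    move=> zB B0 w0B; apply/negP => /sS; rewrite cardB //; apply/negP/avoidS;
      last by rewrite -cardB.
    apply: contra w0B => /imsetP[w wB cw];
      apply: (subsetP (porbit_sub_invariant zB wB)).
    by rewrite zE cw0 cw.
  (* An invariant set containing the short cycle is replaced by its complement. *)
  move=> B zB /andP[B0 BT]; have [w0B|] := boolP (w0 \in B); last exact: avoid0.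
  apply: contra (@invariant_sizesC x B) (avoid0 (~: B) _ _ _).
  - by rewrite perm_imsetC zB.
  - by have := cardsC B; lia.
  - by rewrite inE w0B.
have oddz : odd_perm z = odd n (+) odd k.+1.
  rewrite /odd_perm cardT; congr (_ (+) odd _).
  rewrite -[k.+1]card_ord -(card_imset _ (_ : injective (fun i => c @^-1: [set i]))).
    apply: eq_card => X; apply/imsetP/imsetP => [[w _ ->]|[i _ ->]].
      by exists (c w) => //; apply/setP => y; rewrite zE !inE.
    by have [w <-] := exc i; exists w => //; apply/setP => y; rewrite zE !inE.
  move=> i j /setP E; have [w cw] := exc i.
  by have := E w; rewrite !inE cw eqxx => /esym/eqP.
exists z; split=> //.
  apply: contraTneq l0 => z1; rewrite -cardA -leqNgt dvdn_leq //.
  by apply: porbitX_dvdn; rewrite z1 expg1 perm1.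
move=> x sS; split.
  exists (porbit z w0) => //; apply: avoid => //.
  by rewrite cardA l_gt0 cardT.
move=> a b.
(* Since ['Alt_T] is normal, conjugation reduces the claim to a group containing [z] itself. *)
have -> : [set x ^ a; z ^ b] = [set x ^ (a * b^-1); z ^ 1] :^ b.
  by rewrite conjUg !conjg_set1 -!conjgM mulgKV mul1g.
rewrite genJ -sub_conjgV (normsP (Alt_norm T)) ?inE //.
set H := <<_>>; have zH : z \in H by rewrite mem_gen // conjg1 !inE eqxx orbT.
have trH : forall u v, exists2 g, g \in H & g u = v := gen2_transitive _ _ (avoid x sS).
apply: (primitive_Alt_sub (A := porbit z w0)) => //; rewrite ?cardA ?cardT //.
  apply: (primitive_porbit trH zH (x := w0)).
  - by apply: contraTneq l0n => E; rewrite -cardA E cardsT cardT ltnn.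
  - by move=> w; rewrite ninA cardA cardp; apply: cop.
  - move=> w w' i; rewrite !ninA zE !cardp cw0 => w0' w0'' ww'.
    by apply: far => //; rewrite eq_sym.
  move=> B zB /properP[sAB [w wB wA]] BT; rewrite cardB //= cardT; apply: ndv.
    by rewrite -cw0 imset_f // (subsetP sAB) ?porbit_id.
  rewrite -cardB // -cardA proper_card //=; last by apply/properP; split=> //; exists w.
  by rewrite -cardT -cardsT proper_card // properT.
apply: jordan_set_porbit => // w; rewrite ninA cardA cardp; exact: cop.
Qed.
End InvariantSets.

(** * Common neighbours in the graph *)

Section Graph.
Local Open Scope group_scope.

Lemma Lambda_adj_sym (gT : finGroupType) (G : {group gT}) : symmetric (Lambda_adj G).
Proof.
by move=> C D; rewrite /Lambda_adj /= eq_sym setUC; case: (C \in _) (D \in _) => [] [].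
Qed.

Lemma Xi_adj_sym (gT : finGroupType) (G : {group gT}) : symmetric (Xi_adj G).
Proof. by move=> C D; rewrite /Xi_adj /= Lambda_adj_sym andbCA. Qed.

Lemma exists_common_neighbour c : exists n0, forall n (G : {group {perm 'I_n}}),
    n0 <= n -> G = ('Alt_('I_n))%G \/ G = ('Sym_('I_n))%G ->
  forall C D : {set {perm 'I_n}}, C \in Xi_vertices G -> D \in Xi_vertices G ->
    {in C, forall x, #|porbits x| <= c} -> {in D, forall x, #|porbits x| <= c} ->
  exists2 Z, Xi_adj G C Z & Xi_adj G Z D.
Proof.
(* Each of the two classes contributes at most [2 ^ c] sizes of invariant sets. *)
pose s := (2 ^ c + 2 ^ c)%N.
have [m2 H2] := @exists_admissible 2 s (or_introl erefl).
have [m3 H3] := @exists_admissible 3 s (or_intror erefl).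
exists (m2 + m3)%N => n G le_n dG C D CX DX Cc Dc.
have [CL DL] : C \in Lambda_vertices G /\ D \in Lambda_vertices G.
  by move: CX DX; rewrite !inE => /andP[-> _] /andP[-> _].
have [/setD1P[C1 /imsetP[x xG dC]] /setD1P[D1 /imsetP[y yG dD]]] := (CL, DL).
have xC : x \in C by rewrite dC class_refl.
have yD : y \in D by rewrite dD class_refl.
pose S := invariant_sizes x ++ invariant_sizes y.
have leS : size S <= s.
  by rewrite size_cat !size_invariant_sizes; apply: leq_add; apply: leq_pexp2l => //;
     [exact: Cc | exact: Dc].
have sxS : {subset invariant_sizes x <= S} by move=> m; rewrite mem_cat => ->.
have syS : {subset invariant_sizes y <= S} by move=> m; rewrite mem_cat orbC => ->.
have [z [oddz z1 zS]] : exists z : {perm 'I_n},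
    [/\ odd_perm z = (G != ('Alt_('I_n))%G), z != 1 &
     forall x, {subset invariant_sizes x <= S} ->
       (exists2 B : {set 'I_n}, z @: B = B & #|B| \notin invariant_sizes x) /\
       (forall a b, 'Alt_('I_n) \subset <<[set x ^ a; z ^ b]>>)].
  (* The parity of [z] is that of [n] plus its number of cycles: four cycles serve in the first
     case, three in the second. *)
  have [e|e] := eqVneq (odd n) (G != ('Alt_('I_n))%G).
    have [|l adm] := H3 n S _ leS; first by apply: leq_trans le_n; rewrite leq_addl.
    have [z [oz ? ?]] := admissible_Alt_sub (card_ord n) adm; exists z; split=> //.
    by apply: (etrans oz); rewrite /= addbF.
  have [|l adm] := H2 n S _ leS; first by apply: leq_trans le_n; rewrite leq_addr.
  have [z [oz ? ?]] := admissible_Alt_sub (card_ord n) adm; exists z; split=> //.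
  by apply: (etrans oz); move: e; rewrite /= addbT; case: (odd n) (G != _) => [] [].
have AG : 'Alt_('I_n) \subset G by case: dG => ->; rewrite ?subsetT.
have zG : z \in G.
  case: dG oddz => -> oz; last by rewrite inE.
  by rewrite Alt_even oz eqxx.
(* If [G] is not alternating, [z] is odd, and an odd [g] differs from a conjugate of [z] by an even
   factor. *)
have gen (H : {group {perm 'I_n}}) : H \subset G -> 'Alt_('I_n) \subset H ->
    (exists2 b, b \in G & z ^ b \in H) -> H :=: G.
  move=> sHG sAH [b bG zH]; apply/eqP; rewrite eqEsubset sHG; apply/subsetP => g gG.
  have [gA|gA] := boolP (g \in 'Alt_('I_n)); first exact: (subsetP sAH).
  rewrite -(mulgKV (z ^ b) g) groupM // (subsetP sAH) // Alt_even odd_permM odd_permV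
    odd_permJ oddz.
  rewrite Alt_even negbK in gA; rewrite gA; case: eqP => // E.
  by move: gG; rewrite E Alt_even gA.
have adj w : w \in G -> w ^: G \in Xi_vertices G -> {subset invariant_sizes w <= S} ->
    Xi_adj G (w ^: G) (z ^: G).
  move=> wG wX wS; have [[B zB Bw] gen_w] := zS w wS.
  (* Conjugate permutations have the same sizes of invariant sets, whereas [#|B|] occurs for [z] but
     not for [w]. *)
  have zw : w ^: G != z ^: G.
    apply: contraNneq Bw => E; have : z \in w ^: G by rewrite E class_refl.
    case/imsetP=> b bG dz; apply/invariant_sizesP; exists (b^-1 @: B);
      last by rewrite card_imset_perm.
    by apply: imset_conj; rewrite -dz.
  have w1 : w != 1.
    by move: wX; rewrite !inE => /andP[/andP[+ _] _]; rewrite -(classG_eq1 G).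
  have adj : Lambda_adj G (w ^: G) (z ^: G).
    rewrite Lambda_adjE // w1 z1 zw; apply/invariably_generates_pairP => //.
      by apply: contraNneq zw => ->.
    move=> a b aG bG; apply: (gen <<_>>%G);
      first by rewrite gen_subG subUset !sub1set !groupJ.
      exact: gen_w.
    by exists b; rewrite // mem_gen // !inE eqxx orbT.
  rewrite /Xi_adj /= wX adj andbT inE; have /and4P[_ -> _ _] := adj.
  by apply/existsP; exists (w ^: G); rewrite Lambda_adj_sym.
exists (z ^: G); last rewrite Xi_adj_sym.
  by rewrite dC; apply: adj => //; rewrite -dC.
by rewrite dD; apply: adj => //; rewrite -dD.
Qed.

End Graph.

Theorem theorem4p3
    (Hc : exists c : nat, (0 < c)%N /\
       forall (n : nat) (G : {group {perm 'I_n}}), (5 <= n)%N ->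
         G = ('Alt_('I_n))%G \/ G = ('Sym_('I_n))%G ->
         forall C : {set {perm 'I_n}}, C \in Xi_vertices G ->
         exists D : {set {perm 'I_n}}, Xi_adj G C D /\
           (forall y : {perm 'I_n}, y \in D -> (#|porbits y| <= c)%N)) :
  exists n0 : nat, forall (n : nat) (G : {group {perm 'I_n}}), (n0 <= n)%N ->
    G = ('Alt_('I_n))%G \/ G = ('Sym_('I_n))%G ->
    (diameter (Xi_vertices G) (Xi_adj G) <= (Posz 4)%:E)%E.
Proof.
have [c [_ few]] := Hc; have [n0 common] := exists_common_neighbour c.
exists (maxn 5 n0) => n G; rewrite geq_max => /andP[n5 le_n] dG.
apply/diameter_leP => u v uX vX.
have [D1 [uD1 D1c]] := few n G n5 dG u uX.
have [D2 [vD2 D2c]] := few n G n5 dG v vX.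
have [/and3P[_ D1X _] /and3P[_ D2X _]] := (uD1, vD2).
have [Z D1Z ZD2] := common n G le_n dG D1 D2 D1X D2X D1c D2c.
exists [:: D1; Z; D2; v]; split=> //=.
by rewrite uD1 D1Z ZD2 Xi_adj_sym vD2.
Qed.
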